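(* Let $p,q\in\mathbb N$ be positive and let $F\in (S_{-1})^{p\times q}$ be a $p\times q$ matrix with entries in the (real) Kondratiev space $S_{-1}$. The following are equivalent: (1) The Hermite transform ${\bf I}(F)$ is a rational function, analytic at the origin (that is, it depends only on finitely many of the variables $z_1,z_2,\ldots$ and is the power series expansion at the origin of a rational function of these variables which is analytic at the origin). (2) There are $N,M\in\mathbb N$ and matrices $D\in\mathbb R^{p\times q}$, $C\in\mathbb R^{p\times N}$, $A_1,\ldots,A_M\in\mathbb R^{N\times N}$ and $B_1,\ldots,B_M\in\mathbb R^{N\times q}$ such that $$F=D+C\Big(I_N-\sum_{k=1}^M H_{e_k}A_k\Big)^{-\lozenge}\lozenge\Big(\sum_{k=1}^M H_{e_k}B_k\Big).$$ (3) $F$ is obtained from the elements $H_\alpha$ ($\alpha\in\ell$) and real constant matrices after a finite number of additions, Wick multiplications and Wick inversions of (matrix-valued) elements of compatible dimensions, where the inversions are of the form $G\mapsto (I-G)^{-\lozenge}$ with $G$ square with zero constant coefficient.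
   Context: $\ell$ is the set of sequences $\alpha=(\alpha_1,\alpha_2,\ldots)$ of nonnegative integers with only finitely many nonzero entries; $e_k\in\ell$ has $k$-th entry $1$ and all other entries $0$. $(H_\alpha)_{\alpha\in\ell}$ is the Hermite basis of the white noise space; for the present purpose only formal series in the $H_\alpha$ matter, identified with their coefficient families, and $H_0=1$. For $r\in\mathbb N$ put $(2\mathbb N)^{-r\alpha}=\prod_j(2j)^{-r\alpha_j}$. The Kondratiev space $S_{-1}$ is the set of formal series $F=\sum_{\alpha\in\ell}c_\alpha H_\alpha$, $c_\alpha\in\mathbb R$, with $\sum_\alpha c_\alpha^2(2\mathbb N)^{-r\alpha}<\infty$ for some $r\in\mathbb N$. The Wick product is the bilinear product determined by $H_\alpha\lozenge H_\beta=H_{\alpha+\beta}$, i.e. $\big(\sum f_\alpha H_\alpha\big)\lozenge\big(\sum g_\alpha H_\alpha\big)=\sum_\alpha\big(\sum_{\beta\le\alpha}f_\beta g_{\alpha-\beta}\big)H_\alpha$; it maps $S_{-1}\times S_{-1}$ to $S_{-1}$ and extends to matrices in the usual way. The Hermite transform ${\bf I}$ sends $\sum_\alpha c_\alpha H_\alpha$ to the power series $\sum_\alpha c_\alpha z^\alpha$, where $z=(z_1,z_2,\ldots)$ and $z^\alpha=z_1^{\alpha_1}z_2^{\alpha_2}\cdots$; for matrices it is applied entrywise. For a square matrix $G$ with entries in $S_{-1}$ whose constant coefficient $G_0$ is zero, $(I-G)^{-\lozenge}=\sum_{k=0}^\infty G^{k\lozenge}$, where $G^{k\lozenge}$ is the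 $k$-fold Wick power; this series converges in the Kondratiev space. *)

(* Defs.v *)
From HB Require Import structures.
From mathcomp Require Import all_boot all_order all_algebra finmap multiset.
From mathcomp Require Import all_classical all_reals all_analysis.
(* Required without Import: the notations of mpoly clash with those of
   MathComp-Analysis. *)
From mathcomp Require mpoly.

Set Implicit Arguments.
Unset Strict Implicit.
Unset Printing Implicit Defensive.

Import Order.TTheory GRing.Theory Num.Theory.
Import numFieldNormedType.Exports.

Local Open Scope classical_set_scope.
Local Open Scope ring_scope.

(* Finitely supported maps nat -> nat, that is, finite multisets over nat.
   Indices are shifted by one: [a j] is the entry alpha_(j+1). *)
Definition ell : choiceType := {mset nat}%mset.

Definition below (a : ell) : set ell := [set b : ell | (b `<=` a)%mset].

(* The formal series sum_alpha c_alpha H_alpha, given by its coefficient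
   family; the same type serves for the power series sum_alpha c_alpha z^alpha,
   whose Cauchy product is given by the formula of the Wick product. The alias
   hides the pointwise product that functions into a ring carry in
   MathComp-Analysis. *)
Definition wseries (R : realType) : Type := ell -> R.

Section WickRing.
Variable R : realType.
Implicit Types (f g h : wseries R) (a b : ell).

HB.instance Definition _ := GRing.Zmodule.copy (wseries R) (ell -> R).

Definition wick f g : wseries R :=
  fun a => \sum_(b \in below a) f b * g (a `\` b)%mset.

Definition wconst (c : R) : wseries R := fun b => if b == mset0 then c else 0.

Lemma finite_below a : finite_set (below a).
Proof.
pose N := (\sum_(x <- finsupp a) a x).+1.
pose dec (u : {ffun finsupp a -> 'I_N}) : ell :=
  [fsfun x in finsupp a => oapp (fun y => u y : nat) 0%N (insub x)].
apply: (@sub_finite_set _ _ (dec @` setT)); last first.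
  exact/finite_image/finite_finset.
move=> b /msubsetP ba.
exists [ffun x : finsupp a => inord (b (val x))] => //.
apply/msetP => x; rewrite fsfunE; case: (boolP (x \in finsupp a)) => xa; last first.
  by have := ba x; rewrite (fsfun_dflt xa) leqn0 => /eqP ->.
rewrite insubT /= ffunE inordK //= ltnS (leq_trans (ba x)) //.
by rewrite (big_fsetD1 x) //= leq_addr.
Qed.

Let S a : seq ell := fset_set (below a).

Let memS a b : (b \in S a) = (b `<=` a)%mset.
Proof.
rewrite /S in_fset_set; last exact: finite_below.
by apply/idP/idP; rewrite inE.
Qed.

Let wickE f g a : wick f g a = \sum_(b <- S a) f b * g (a `\` b)%mset.
Proof. by rewrite /wick fsbig_finite //; exact: finite_below. Qed.

Let uniqS a : uniq (S a). Proof. exact: fset_uniq. Qed.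

Let mBK a b : (b `<=` a)%mset -> (a `\` (a `\` b))%mset = b.
Proof.
by move=> /msubsetP ba; apply/msetP => x; rewrite !msetE2 subKn.
Qed.

Let mB_sub a b : (a `\` b `<=` a)%mset.
Proof. by apply/msubsetP => x; rewrite !msetE2 leq_subr. Qed.

Fact wickC : commutative wick.
Proof.
move=> f g; apply/funext => a; rewrite !wickE.
have P : perm_eq (S a) [seq (a `\` b)%mset | b <- S a].
  apply: uniq_perm => //.
    rewrite map_inj_in_uniq // => b c; rewrite !memS => ba ca e.
    by rewrite -(mBK ba) e mBK.
  move=> b; rewrite memS; apply/idP/mapP => [ba|[c _ ->]]; last exact: mB_sub.
  by exists (a `\` b)%mset; rewrite ?mBK // memS mB_sub.
rewrite (perm_big _ P) /= big_map big_seq [RHS]big_seq.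
by apply: eq_bigr => b; rewrite memS => ba; rewrite mBK // mulrC.
Qed.

Fact wickA : associative wick.
Proof.
move=> f g h; apply/funext => a; rewrite !wickE.
transitivity (\sum_(d <- S a) \sum_(b <- S a | (b `<=` d)%mset)
    f b * g (d `\` b)%mset * h (a `\` d)%mset); last first.
  rewrite big_seq [RHS]big_seq; apply: eq_bigr => d; rewrite memS => da.
  rewrite wickE big_distrl /= -big_filter; apply: perm_big.
  apply: uniq_perm; rewrite ?filter_uniq // => b.
  rewrite mem_filter !memS andbC; case: (boolP (b `<=` d)%mset) => bd.
    by rewrite andbT (msubset_trans bd da).
  by rewrite andbF.
rewrite (exchange_big_dep predT) //= big_seq [RHS]big_seq.
apply: eq_bigr => b; rewrite memS => /msubsetP ba.
rewrite wickE big_distrr /= -[RHS]big_filter.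
have P : perm_eq [seq d <- S a | (b `<=` d)%mset]
                 [seq (b `+` c)%mset | c <- S (a `\` b)%mset].
  apply: uniq_perm; first by rewrite filter_uniq.
    rewrite map_inj_uniq // => c d e.
    by rewrite -(msetDKB b c) -(msetDKB b d) e.
  move=> d; rewrite mem_filter memS; apply/andP/mapP => [[]|[c + ->]].
    move=> /msubsetP bd /msubsetP da; exists (d `\` b)%mset.
      by rewrite memS; apply/msubsetP => x; rewrite !msetE2 leq_sub2r.
    by apply/msetP => x; rewrite !msetE2 subnKC.
  rewrite memS => /msubsetP cab; split; apply/msubsetP => x.
    by rewrite msetE2 leq_addr.
  by have := cab x; rewrite !msetE2 leq_subRL // ba.
rewrite (perm_big _ P) /= big_map; apply: eq_bigr => c _.
rewrite mulrA; congr (_ * g _ * h _); apply/msetP => x; rewrite !msetE2.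
  by rewrite addKn.
by rewrite subnDA.
Qed.

Fact wick1 : left_id (wconst 1) wick.
Proof.
move=> f; apply/funext => a; rewrite wickE (bigD1_seq mset0) //=; last first.
  by rewrite memS; apply/msubsetP => x; rewrite mset0E.
rewrite big1 => [|b /negbTE b0]; last by rewrite /wconst b0 mul0r.
rewrite /wconst eqxx mul1r addr0; congr f.
by apply/msetP => x; rewrite msetE2 mset0E subn0.
Qed.

Fact wickDl : left_distributive wick +%R.
Proof.
move=> f g h; apply/funext => a; rewrite -[RHS]/(wick f h a + wick g h a) !wickE.
by rewrite -big_split /=; apply: eq_bigr => b _; rewrite -mulrDl.
Qed.

Fact wconst1_neq0 : wconst 1 != 0.
Proof.
apply/eqP => /(congr1 (fun f : wseries R => f mset0)).
by rewrite /wconst eqxx => /eqP; rewrite oner_eq0.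
Qed.

HB.instance Definition _ := GRing.Zmodule_isComNzRing.Build (wseries R)
  wickA wickC wick1 wickDl wconst1_neq0.

End WickRing.

Section WhiteNoise.
Variable R : realType.

Definition Hbasis (a : ell) : wseries R := fun b => (b == a)%:R.

Definition unit_index (k : nat) : ell := [mset k]%mset.

(* (2N)^(- r alpha) *)
Definition weight (r : nat) (a : ell) : R :=
  \prod_(j <- finsupp a) (2 * j.+1)%:R ^- (r * a j).

Definition kondratiev (F : wseries R) : Prop :=
  exists r : nat, (\esum_(a in [set: ell]) (F a ^+ 2 * weight r a)%:E < +oo)%E.

(* H_alpha |-> z^alpha changes the reading of the coefficient family, not the
   family itself. *)
Definition hermite (F : wseries R) : wseries R := F.

Definition cst_mx m n (D : 'M[R]_(m, n)) : 'M[wseries R]_(m, n) :=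
  map_mx (@wconst R) D.

Definition const_coef m n (G : 'M[wseries R]_(m, n)) : 'M[R]_(m, n) :=
  map_mx (fun f : wseries R => f mset0) G.

(* (I - G)^(-lozenge) = sum_k G^(k lozenge), summed coefficientwise; meaningful
   when const_coef G = 0. *)
Definition wick_inv n (G : 'M[wseries R]_n) : 'M[wseries R]_n :=
  \matrix_(i, j) ((fun a => limn (series (fun k => (G ^+ k) i j a))) : wseries R).

(* The power series of the polynomial P(z_1, ..., z_n): the family of the
   variable z_k is that of H_(e_k). *)
Definition series_of_poly n (P : mpoly.mpoly n R) : wseries R :=
  mpoly.mmap (@wconst R) (fun k : 'I_n => Hbasis (unit_index k)) P.

(* The power series f is the expansion at the origin of a rational function
   P / Q of z_1, ..., z_n whose denominator does not vanish there: as Q is then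
   invertible among power series, that expansion is the only f with Q f = P. *)
Definition rational_at0 n (f : wseries R) : Prop :=
  exists P Q : mpoly.mpoly n R,
    mpoly.meval (fun=> 0) Q != 0 /\
    series_of_poly Q * f = series_of_poly P.

Definition rational_mx_at0 p q (F : 'M[wseries R]_(p, q)) : Prop :=
  exists n : nat, forall i j, rational_at0 n (F i j).

Inductive wick_generated : forall p q, 'M[wseries R]_(p, q) -> Prop :=
| wg_Hbasis (a : ell) :
    wick_generated (\matrix_(i < 1, j < 1) Hbasis a)
| wg_const p q (D : 'M[R]_(p, q)) :
    wick_generated (cst_mx D)
| wg_add p q (F G : 'M[wseries R]_(p, q)) :
    wick_generated F -> wick_generated G -> wick_generated (F + G)
| wg_mul p q s (F : 'M[wseries R]_(p, q)) (G : 'M[wseries R]_(q, s)) :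
    wick_generated F -> wick_generated G -> wick_generated (F *m G)
| wg_inv n (G : 'M[wseries R]_n) :
    const_coef G = 0 -> wick_generated G -> wick_generated (wick_inv G).

End WhiteNoise.

(* Main.v *)
(* Write a realizable F in state-space form: F = D + C X, where X is the unique
   solution of X = A X + B, and A, B have entries in the span of the H_(e_k).
   Constants and the H_(e_k) have this form, and the form is preserved by sums,
   products and the inversions (I - G)^(-lozenge): if G = C X, then the state
   of the inverse Z is X Z, and X Z = (A + B C) X Z + B. This gives (3) => (2),
   and (1) => (2) since a rational function P / Q is obtained from polynomials
   by such operations. Conversely det (I - A) clears the denominators of a
   realization. The Neumann series defining the inverse is handled through the
   filtration of the series by total degree, for which it is locally finite. *)
Require Import Defs.
From HB Require Import structures.
From mathcomp Require Import all_boot all_order all_algebra finmap multiset.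
From mathcomp Require Import all_classical all_reals all_analysis.
From mathcomp Require mpoly.
Import (canonicals) mpoly.

Set Implicit Arguments.
Unset Strict Implicit.
Unset Printing Implicit Defensive.

Import Order.TTheory GRing.Theory Num.Theory.
Import numFieldNormedType.Exports.

Local Open Scope ring_scope.

(** * Total degree and the filtration of series by it *)

Section Order.
Variable R : realType.
Implicit Types (f g : wseries R) (a b : ell) (c d : R).

(** [enum_mset] lists indices with multiplicity, so this is the total degree alpha_1 + alpha_2 +
    ... *)
Definition degree a : nat := size (enum_mset a).

Lemma degreeD a b : degree (a `+` b)%mset = (degree a + degree b)%N.
Proof.
have -> : (a `+` b)%mset = seq_mset (enum_mset a ++ enum_mset b).
  by apply/msetP => x; rewrite mset_seqE count_cat !count_mem_mset msetE2.
by rewrite /degree (perm_size (perm_eq_seq_mset _)) size_cat.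
Qed.

Lemma degree_unit_index k : degree (unit_index k) = 1.
Proof. by rewrite /degree /unit_index enum_msetn. Qed.

Definition below_seq a : seq ell := fset_set (below a).

Lemma wickE f g a :
  (f * g) a = \sum_(b <- below_seq a) f b * g (a `\` b)%mset.
Proof. by rewrite -fsbig_finite //; exact: finite_below. Qed.

Lemma mem_below a b : (b \in below_seq a) = (b `<=` a)%mset.
Proof.
rewrite /below_seq in_fset_set; last exact: finite_below.
by apply/idP/idP; rewrite inE.
Qed.

Lemma wconst_wickE c f a : (wconst c * f) a = c * f a.
Proof.
rewrite wickE (bigD1_seq mset0) ?fset_uniq //=; last first.
  by rewrite mem_below; apply/msubsetP => x; rewrite mset0E.
rewrite big1 => [|b /negbTE b0]; last by rewrite /wconst b0 mul0r.
rewrite /wconst eqxx addr0; congr (_ * f _).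
by apply/msetP => x; rewrite msetE2 mset0E subn0.
Qed.

Lemma wickE0 f g : (f * g) mset0 = f mset0 * g mset0.
Proof.
(* Split off the constant part of [f]: only [mset0] lies below [mset0], and there the rest of [f]
   vanishes. *)
have -> : f * g = wconst (f mset0) * g + (f - wconst (f mset0)) * g.
  by rewrite -mulrDl addrC subrK.
rewrite -[LHS]/(_ mset0 + _ mset0) wconst_wickE [X in _ + X]wickE.
rewrite big_seq big1 ?addr0 // => b; rewrite mem_below => /msubsetP b0.
suff -> : b = mset0.
  by rewrite -[X in X * _]/(f _ - wconst _ _) /wconst eqxx subrr mul0r.
by apply/msetP => x; have := b0 x; rewrite mset0E leqn0 => /eqP.
Qed.

Fact wconst_is_zmod_morphism : zmod_morphism (@wconst R).
Proof.
move=> c d; apply/funext => b.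
by rewrite -[RHS]/(wconst c b - wconst d b) /wconst; case: ifP; rewrite ?subr0.
Qed.

Fact wconst_is_monoid_morphism : monoid_morphism (@wconst R).
Proof.
split=> // c d; apply/funext => b.
by rewrite wconst_wickE /wconst; case: ifP; rewrite ?mulr0.
Qed.

HB.instance Definition _ :=
  GRing.isZmodMorphism.Build R (wseries R) (@wconst R) wconst_is_zmod_morphism.
HB.instance Definition _ :=
  GRing.isMonoidMorphism.Build R (wseries R) (@wconst R)
    wconst_is_monoid_morphism.

(** Scalar form of [const_coef], named so that it can carry a ring morphism structure and the
    [map_mx] lemmas apply. *)
Definition const_term f : R := f mset0.

Lemma const_term_wconst c : const_term (wconst c) = c.
Proof. by rewrite /const_term /wconst eqxx. Qed.

Fact const_term_is_zmod_morphism : zmod_morphism const_term.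
Proof. by []. Qed.

Fact const_term_is_monoid_morphism : monoid_morphism const_term.
Proof. by split=> [|f g]; [exact: const_term_wconst | exact: wickE0]. Qed.

HB.instance Definition _ :=
  GRing.isZmodMorphism.Build (wseries R) R const_term const_term_is_zmod_morphism.
HB.instance Definition _ :=
  GRing.isMonoidMorphism.Build (wseries R) R const_term
    const_term_is_monoid_morphism.

(** The n-th step of the degree filtration: the ideal of series of order at least [n]. *)
Definition vanish n f := forall a, (degree a < n)%N -> f a = 0.

Lemma vanishD n f g : vanish n f -> vanish n g -> vanish n (f + g).
Proof.
by move=> vf vg a an; rewrite -[LHS]/(f a + g a) vf // vg // addr0.
Qed.

(** When [degree a < m + n], each splitting of [a] has its first part of degree below [m] or its
    second below [n]. *)
Lemma vanishM m n f g : vanish m f -> vanish n g -> vanish (m + n) (f * g).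
Proof.
move=> vf vg a; rewrite wickE big_seq => an; apply: big1 => b.
rewrite mem_below => /msubsetP ba.
case: (ltnP (degree b) m) => [/vf ->|mb]; first by rewrite mul0r.
rewrite vg ?mulr0 // -(ltn_add2l (degree b)) -degreeD.
have -> : (b `+` (a `\` b))%mset = a.
  by apply/msetP => x; rewrite !msetE2 subnKC.
by apply: leq_trans an _; rewrite leq_add2r.
Qed.

Lemma vanish_sum n (I : Type) (s : seq I) (P : pred I) (F : I -> wseries R) :
  (forall i, P i -> vanish n (F i)) -> vanish n (\sum_(i <- s | P i) F i).
Proof. by move=> vF; elim/big_ind : _ => //; exact: vanishD. Qed.

Lemma vanish1 f : const_term f = 0 -> vanish 1 f.
Proof.
move=> f0 a; rewrite ltnS leqn0 => /eqP/size0nil a0; rewrite -[RHS]f0.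
by congr f; apply/msetP => x; rewrite -count_mem_mset a0 mset0E.
Qed.

(** The filtration is separated: equalities of series can be checked modulo each degree, with no
    topology. *)
Lemma vanish_eq0 f : (forall n, vanish n f) -> f = 0.
Proof. by move=> vf; apply/funext => a; exact: (vf (degree a).+1). Qed.

End Order.

(** * The Neumann series and its fixed-point equation *)

Section WickInverse.
Variable R : realType.
Implicit Types n : nat.

Lemma vanish_mulmx m n p k l (X : 'M[wseries R]_(m, n)) (Y : 'M[wseries R]_(n, p)) :
    (forall i j, vanish k (X i j)) -> (forall i j, vanish l (Y i j)) ->
  forall i j, vanish (k + l) ((X *m Y) i j).
Proof.
by move=> vX vY i j; rewrite mxE; apply: vanish_sum => h _; exact: vanishM.
Qed.

Lemma const_coef_mulmx m n p (X : 'M[wseries R]_(m, n)) (Y : 'M[wseries R]_(n, p)) :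
  const_coef (X *m Y) = const_coef X *m const_coef Y.
Proof. exact: (map_mxM (@const_term R)). Qed.

Lemma const_coef_addmx m n (X Y : 'M[wseries R]_(m, n)) :
  const_coef (X + Y) = const_coef X + const_coef Y.
Proof. exact: (map_mxD (@const_term R)). Qed.

Section Inverse.
Variables (n : nat) (G : 'M[wseries R]_n).
Hypothesis G0 : const_coef G = 0.

Lemma vanish_expmx k i j : vanish k ((G ^+ k) i j).
Proof.
elim: k i j => [//|k IHk]; rewrite exprS; apply: (@vanish_mulmx _ _ _ 1 k) => // i j.
by apply: vanish1; move/matrixP/(_ i j): G0; rewrite !mxE.
Qed.

(** By [vanish_expmx], the powers from [k] on do not touch coefficients of degree below [k]: there
    the partial sums are eventually constant. *)
Lemma wick_inv_vanish k i j :
  vanish k ((wick_inv G - \sum_(h < k) G ^+ h) i j).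
Proof.
move=> a ak; rewrite mxE [X in X + _]mxE [X in _ + X]mxE.
suff E : limn (series (fun h => (G ^+ h) i j a)) =
          (\sum_(h < k) G ^+ h) i j a.
  by have := subrr ((\sum_(h < k) G ^+ h) i j a); rewrite -{1}E.
apply: lim_near_cst => //; exists k => // l /= kl.
rewrite /series /= summxE big_mkord.
have -> : (\sum_(h < k) (G ^+ h) i j) a = \sum_(h < k) (G ^+ h) i j a.
  by rewrite (big_morph (fun f : wseries R => f a)
    (_ : {morph _ : f g / f + g}) (erefl 0)).
rewrite -!(big_mkord predT (fun h => (G ^+ h) i j a)) (big_cat_nat _ kl) //=.
rewrite [X in _ + X]big_nat [X in _ + X]big1 ?addr0 // => h /andP[kh _].
exact/vanish_expmx/(leq_trans ak).
Qed.

(** Modulo degree [k] the inverse is a finite geometric sum S, and (I - G) S = I - G^k with G^k of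
    order at least [k]; [k] is arbitrary. *)
Lemma mulmx_wick_inv : (1%:M - G) *m wick_inv G = 1%:M.
Proof.
suff E i j : ((1%:M - G) *m wick_inv G - 1%:M) i j = 0.
  by apply/eqP; rewrite -subr_eq0; apply/eqP/matrixP => i j; rewrite E mxE.
apply: vanish_eq0 => k.
have -> : (1%:M - G) *m wick_inv G - 1%:M =
    (1%:M - G) *m (wick_inv G - \sum_(h < k) G ^+ h) - G ^+ k.
  rewrite mulmxBr -[in RHS]addrA -opprD; congr (_ - _).
  have := subrX1 G k; rewrite -[_ * _]/(_ *m _) -[1]/(1%:M) => E.
  by rewrite -[1%:M - G]opprB mulNmx -E opprB subrK.
rewrite mxE; apply: vanishD.
  by apply: (@vanish_mulmx _ _ _ 0 k) => [i0 j0 a|]; last exact: wick_inv_vanish.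
by rewrite mxE => a ak; rewrite -[LHS]/(- _ a) vanish_expmx ?oppr0.
Qed.

(** A one-sided inverse of a square matrix over a commutative ring is two-sided. *)
Lemma mul_wick_inv_mx : wick_inv G *m (1%:M - G) = 1%:M.
Proof. exact/mulmx1C/mulmx_wick_inv. Qed.

(** Trades the inverse for a linear equation; the later proofs reason about [wick_inv] only in this
    way. *)
Lemma wick_inv_unique q (X B : 'M[wseries R]_(n, q)) :
  X = G *m X + B <-> X = wick_inv G *m B.
Proof.
split=> [XE|->].
  rewrite -{1}[X]mul1mx -mul_wick_inv_mx -mulmxA mulmxBl mul1mx {1}XE.
  by rewrite addrAC subrr add0r.
rewrite -{3}[B]mul1mx -mulmx_wick_inv -mulmxA mulmxBl mul1mx.
by rewrite addrC subrK.
Qed.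

End Inverse.
End WickInverse.

(** * Linear forms in the H_(e_k) *)

Section LinearForms.
Variable R : realType.
Implicit Types (f g : wseries R) (n k : nat) (c : R).

(** Phrased on coefficients so that closure properties are pointwise; [linear_formE] recovers the
    combination of basis elements. *)
Definition linear_form n f :=
  forall b, (forall k, (k < n)%N -> b != unit_index k) -> f b = 0.

Definition linear_mx n r s (L : 'M[wseries R]_(r, s)) :=
  forall i j, linear_form n (L i j).

Lemma linear_formD n f g :
  linear_form n f -> linear_form n g -> linear_form n (f + g).
Proof.
by move=> lf lg b bn; rewrite -[LHS]/(f b + g b) lf // lg // addr0.
Qed.

Lemma linear_form_wconst n c f : linear_form n f -> linear_form n (wconst c * f).
Proof. by move=> lf b bn; rewrite wconst_wickE lf // mulr0. Qed.

Lemma linear_form_sum n (I : Type) (s : seq I) (P : pred I)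
    (F : I -> wseries R) :
  (forall i, P i -> linear_form n (F i)) ->
  linear_form n (\sum_(i <- s | P i) F i).
Proof. by move=> lF; elim/big_ind : _ => //; exact: linear_formD. Qed.

Lemma linear_form_Hbasis n k : (k < n)%N -> linear_form n (Hbasis R (unit_index k)).
Proof. by move=> kn b /(_ _ kn)/negbTE bk; rewrite /Hbasis bk. Qed.

Lemma linear_form_le m n f : (m <= n)%N -> linear_form m f -> linear_form n f.
Proof.
by move=> mn lf b bn; apply: lf => k km; apply: bn; exact: leq_trans mn.
Qed.

Lemma unit_index_inj : injective unit_index.
Proof.
move=> j k /msetP/(_ j); rewrite /unit_index msetnxx msetnE.
by case: eqP.
Qed.

Lemma const_term_linear_form n f : linear_form n f -> const_term f = 0.
Proof.
apply => k _; apply/eqP => /(congr1 degree).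
by rewrite degree_unit_index /degree enum_mset0.
Qed.

Lemma const_coef_linear_mx n r s (L : 'M[wseries R]_(r, s)) :
  linear_mx n L -> const_coef L = 0.
Proof.
by move=> lL; apply/matrixP => i j; rewrite !mxE;
  exact: const_term_linear_form (lL i j).
Qed.

Lemma linear_formE n f : linear_form n f ->
  f = \sum_(k < n) Hbasis R (unit_index k) * wconst (f (unit_index k)).
Proof.
move=> lf; apply/funext => b.
rewrite (big_morph (fun g : wseries R => g b) (_ : {morph _ : g h / g + h})
  (erefl 0)) //.
under eq_bigr do rewrite mulrC wconst_wickE /Hbasis.
have [[k kn ->]|nb] := pselect (exists2 k, (k < n)%N & b = unit_index k).
  rewrite (bigD1 (Ordinal kn)) //= eqxx mulr1 big1 ?addr0 // => i ik.
  by rewrite (inj_eq unit_index_inj) eq_sym -[k]/(val (Ordinal kn)) val_eqE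
    (negbTE ik) mulr0.
have bn k : (k < n)%N -> b != unit_index k.
  by move=> kn; apply/eqP => bk; apply: nb; exists k.
by rewrite lf // big1 // => i _; rewrite (negbTE (bn _ _)) ?mulr0.
Qed.

(** Gives access to the sums with matrix coefficients that occur in (2). *)
Lemma linear_mxP n r s (L : 'M[wseries R]_(r, s)) :
  linear_mx n L <-> exists A : 'I_n -> 'M[R]_(r, s),
    L = \sum_(k < n) Hbasis R (unit_index k) *: cst_mx (A k).
Proof.
split=> [lL|[A ->] i j].
  exists (fun k => \matrix_(i, j) L i j (unit_index k)).
  apply/matrixP => i j; rewrite [LHS](linear_formE (lL i j)) summxE.
  by apply: eq_bigr => k _; rewrite !mxE.
rewrite summxE; apply: linear_form_sum => k _; rewrite !mxE mulrC.
exact/linear_form_wconst/linear_form_Hbasis.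
Qed.

Lemma linear_mx0 n r s : linear_mx n (0 : 'M[wseries R]_(r, s)).
Proof. by move=> i j b _; rewrite mxE. Qed.

Lemma linear_mxD n r s (L K : 'M[wseries R]_(r, s)) :
  linear_mx n L -> linear_mx n K -> linear_mx n (L + K).
Proof. by move=> lL lK i j; rewrite mxE; exact: linear_formD. Qed.

Lemma linear_mx_mulr n r s t (L : 'M[wseries R]_(r, s)) (D : 'M[R]_(s, t)) :
  linear_mx n L -> linear_mx n (L *m cst_mx D).
Proof.
move=> lL i j; rewrite mxE; apply: linear_form_sum => k _.
by rewrite [cst_mx _ _ _]mxE mulrC; exact: linear_form_wconst.
Qed.

Lemma linear_mx_row n r s t (L : 'M[wseries R]_(r, s)) (K : 'M[wseries R]_(r, t)) :
  linear_mx n L -> linear_mx n K -> linear_mx n (row_mx L K).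
Proof. by move=> lL lK i j; rewrite mxE; case: (fintype.split j). Qed.

Lemma linear_mx_col n r s t (L : 'M[wseries R]_(r, t)) (K : 'M[wseries R]_(s, t)) :
  linear_mx n L -> linear_mx n K -> linear_mx n (col_mx L K).
Proof. by move=> lL lK i j; rewrite mxE; case: (fintype.split i). Qed.

Lemma linear_mx_block n r s t u (L1 : 'M[wseries R]_(r, t))
    (L2 : 'M[wseries R]_(r, u)) (L3 : 'M[wseries R]_(s, t))
    (L4 : 'M[wseries R]_(s, u)) :
  linear_mx n L1 -> linear_mx n L2 -> linear_mx n L3 -> linear_mx n L4 ->
  linear_mx n (block_mx L1 L2 L3 L4).
Proof. by move=> *; apply: linear_mx_col; exact: linear_mx_row. Qed.

End LinearForms.

(** * Realizations and their closure properties *)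

Section Realizations.
Variable R : realType.

(* State-space form of the realization: X solves X = A X + B, so that
   X = (I - A)^(-1) B. No inverse occurs, which makes the closure properties
   block matrix computations. *)
Definition realization n p q (F : 'M[wseries R]_(p, q)) :=
  exists (N : nat) (X : 'M[wseries R]_(N, q)) (A : 'M[wseries R]_N)
         (B : 'M[wseries R]_(N, q)) (C : 'M[R]_(p, N)) (D : 'M[R]_(p, q)),
    [/\ linear_mx n A, linear_mx n B, X = A *m X + B
      & F = cst_mx D + cst_mx C *m X].

(** [linear_mxP] yields the coefficient matrices, and [wick_inv_unique] solves X = A X + B, as a
    linear A has zero constant coefficient. *)
Lemma realizationP n p q (F : 'M[wseries R]_(p, q)) :
  realization n F <->
  exists (N : nat) (D : 'M[R]_(p, q)) (C : 'M[R]_(p, N))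
         (A : 'I_n -> 'M[R]_N) (B : 'I_n -> 'M[R]_(N, q)),
    F = cst_mx D + cst_mx C
          *m wick_inv (\sum_(k < n) Hbasis R (unit_index k) *: cst_mx (A k))
          *m (\sum_(k < n) Hbasis R (unit_index k) *: cst_mx (B k)).
Proof.
split=> [[N [X [A' [B' [C [D [lA lB XE ->]]]]]]]|[N [D [C [A [B ->]]]]]].
  have A0 := const_coef_linear_mx lA.
  have [A AE] := (linear_mxP _ _).1 lA; have [B BE] := (linear_mxP _ _).1 lB.
  exists N, D, C, A, B; rewrite -AE -BE -mulmxA; congr (_ + _ *m _).
  exact/wick_inv_unique.
set A' := (X in wick_inv X); set B' := (X in _ *m X).
have lA : linear_mx n A' by apply/linear_mxP; exists A.
have lB : linear_mx n B' by apply/linear_mxP; exists B.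
exists N, (wick_inv A' *m B'), A', B', C, D; split => //; last first.
  by rewrite mulmxA.
exact/(wick_inv_unique (const_coef_linear_mx lA)).
Qed.

Lemma realization_le m n p q (F : 'M[wseries R]_(p, q)) :
  (m <= n)%N -> realization m F -> realization n F.
Proof.
move=> mn [N [X [A [B [C [D [lA lB XE FE]]]]]]].
by exists N, X, A, B, C, D; split => // i j; exact: linear_form_le mn _.
Qed.

Lemma realization_cst n p q (D : 'M[R]_(p, q)) : realization n (cst_mx D).
Proof.
(* The state space has dimension 0, so all matrices but [D] are empty. *)
exists 0, 0, 0, 0, 0, D; split; try exact: linear_mx0.
  by rewrite mulmx0 addr0.
by rewrite mulmx0 addr0.
Qed.

Lemma cst_mx1 n : cst_mx 1%:M = 1%:M :> 'M[wseries R]_n.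
Proof. exact: map_mx1. Qed.

Lemma cst_mx0 p q : cst_mx 0 = 0 :> 'M[wseries R]_(p, q).
Proof. exact: map_mx0. Qed.

Lemma realization_linear n p q (L : 'M[wseries R]_(p, q)) :
  linear_mx n L -> realization n L.
Proof.
(* [L] is its own state, with zero state matrix, and is read out by the identity. *)
move=> lL; exists p, L, 0, L, 1%:M, 0; split => //; first exact: linear_mx0.
  by rewrite mul0mx add0r.
by rewrite cst_mx0 add0r cst_mx1 mul1mx.
Qed.

(** Parallel connection: the two states are stacked and do not interact. *)
Lemma realizationD n p q (F G : 'M[wseries R]_(p, q)) :
  realization n F -> realization n G -> realization n (F + G).
Proof.
move=> [N1 [X1 [A1 [B1 [C1 [D1 [lA1 lB1 XE1 ->]]]]]]].
move=> [N2 [X2 [A2 [B2 [C2 [D2 [lA2 lB2 XE2 ->]]]]]]].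
exists (N1 + N2), (col_mx X1 X2), (block_mx A1 0 0 A2), (col_mx B1 B2),
  (row_mx C1 C2), (D1 + D2); split.
- by apply: linear_mx_block => //; exact: linear_mx0.
- exact: linear_mx_col.
- by rewrite mul_block_col !mul0mx addr0 add0r add_col_mx -XE1 -XE2.
- by rewrite /cst_mx map_row_mx mul_row_col map_mxD addrACA.
Qed.

(* With F = D1 + C1 X1 and G = D2 + C2 X2, the product F G is an output of the
   state (X1 G, X2). *)
Lemma realizationM n p q r (F : 'M[wseries R]_(p, q)) (G : 'M[wseries R]_(q, r)) :
  realization n F -> realization n G -> realization n (F *m G).
Proof.
move=> [N1 [X1 [A1 [B1 [C1 [D1 [lA1 lB1 XE1 ->]]]]]]].
move=> [N2 [X2 [A2 [B2 [C2 [D2 [lA2 lB2 XE2 GE]]]]]]].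
(* In X1 G = A1 X1 G + B1 G the last term is B1 D2 + B1 C2 X2, where only constants multiply B1, so
   linearity is kept. *)
exists (N1 + N2), (col_mx (X1 *m G) X2),
  (block_mx A1 (B1 *m cst_mx C2) 0 A2), (col_mx (B1 *m cst_mx D2) B2),
  (row_mx C1 (D1 *m C2)), (D1 *m D2); split.
- by apply: linear_mx_block => //; [exact: linear_mx_mulr | exact: linear_mx0].
- by apply: linear_mx_col => //; exact: linear_mx_mulr.
- rewrite mul_block_col mul0mx add0r add_col_mx -XE2 {1}XE1 mulmxDl.
  by rewrite {2}GE mulmxDr !mulmxA [_ + B1 *m _ *m _]addrC addrA addrAC.
- rewrite /cst_mx map_row_mx mul_row_col !map_mxM mulmxDl {1}GE mulmxDr.
  by rewrite !mulmxA -addrA [_ + _ *m G]addrC.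
Qed.

Lemma realization_wick_inv n N (G : 'M[wseries R]_N) :
  const_coef G = 0 -> realization n G -> realization n (wick_inv G).
Proof.
move=> G0 [K [X [A [B [C [D [lA lB XE GE]]]]]]].
have X0 : const_coef X = 0.
  rewrite XE const_coef_addmx const_coef_mulmx.
  by rewrite (const_coef_linear_mx lA) (const_coef_linear_mx lB) mul0mx addr0.
(* [X] has no constant part, so the constant coefficient of D + C X is D, which [G0] makes zero. *)
have {GE} GE : G = cst_mx C *m X.
  rewrite GE; suff -> : D = 0 by rewrite cst_mx0 add0r.
  apply/matrixP => i j; move/matrixP/(_ i j) : G0.
  rewrite GE const_coef_addmx const_coef_mulmx X0 mulmx0 addr0 !mxE.
  by rewrite -/(const_term _) const_term_wconst.
set Z := wick_inv G.
have ZE : Z = 1%:M + cst_mx C *m (X *m Z).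
  rewrite mulmxA -GE addrC; apply/(wick_inv_unique G0).
  by rewrite mulmx1.
exists K, (X *m Z), (A + B *m cst_mx C), B, C, 1%:M; split => //.
- by apply: linear_mxD => //; exact: linear_mx_mulr.
(* Expanding B Z by Z = I + C X Z moves B C into the state matrix. *)
- rewrite {1}XE !mulmxDl -addrA -!mulmxA; congr (_ + _).
  by rewrite {1}ZE mulmxDr mulmx1 addrC.
- by rewrite cst_mx1.
Qed.

End Realizations.

(** * Reduction to single entries and to the H_(e_k) *)

Section Entries.
Variable R : realType.

Lemma mx11_scalar_series (f : wseries R) : \matrix_(i < 1, j < 1) f = f%:M.
Proof. by apply/matrixP => i j; rewrite !ord1 !mxE. Qed.

(** Reduces matrices to 1 x 1 blocks using only sums and products with constant matrices, which
    realizations and generated matrices both allow. *)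
Lemma entries_decomposition p q (F : 'M[wseries R]_(p, q)) :
  F = \sum_(i < p) \sum_(j < q)
        cst_mx (delta_mx i (0 : 'I_1)) *m (F i j)%:M *m cst_mx (delta_mx 0 j).
Proof.
rewrite [LHS]matrix_sum_delta; apply: eq_bigr => i _; apply: eq_bigr => j _.
by rewrite /cst_mx !map_delta_mx mul_mx_scalar -scalemxAl mul_delta_mx.
Qed.

Lemma Hbasis_wickE a (f : wseries R) b :
  (Hbasis R a * f) b = if (a `<=` b)%mset then f (b `\` a)%mset else 0.
Proof.
rewrite wickE; case: ifP => ab.
  rewrite (bigD1_seq a) ?fset_uniq ?mem_below //= /Hbasis eqxx mul1r big1 ?addr0 //.
  by move=> c /negbTE ->; rewrite mul0r.
rewrite big_seq big1 // => c; rewrite mem_below /Hbasis.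
by case: eqP => [->|_]; rewrite ?ab ?mul0r.
Qed.

Lemma HbasisD a b : Hbasis R (a `+` b)%mset = Hbasis R a * Hbasis R b.
Proof.
apply/funext => c; rewrite Hbasis_wickE /Hbasis; case: ifPn => [/msubsetP ac|ac].
  congr (nat_of_bool _)%:R; apply/eqP/eqP => [->|<-]; apply/msetP => x.
    by rewrite !msetE2 addKn.
  by rewrite !msetE2 subnKC.
suff /negbTE -> : c != (a `+` b)%mset by [].
by apply: contra ac => /eqP ->; apply/msubsetP => x; rewrite msetE2 leq_addr.
Qed.

Lemma Hbasis0 : Hbasis R (mset0 : ell) = 1.
Proof.
apply/funext => b; rewrite -(rmorph1 (@wconst R)) /Hbasis /= /wconst.
by case: ifP => _; rewrite ?mulr1n ?mulr0n.
Qed.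

(** Reduces H_alpha to basis elements of degree one, which are linear forms and hence realizable. *)
Lemma Hbasis_seq (s : seq nat) :
  Hbasis R (seq_mset s) = \prod_(k <- s) Hbasis R (unit_index k).
Proof.
elim: s => [|k s IHs].
  rewrite big_nil -Hbasis0; congr Hbasis.
  by apply/msetP => x; rewrite mset_seqE mset0E.
rewrite big_cons -IHs -HbasisD; congr Hbasis.
by apply/msetP => x; rewrite mset1DE !mset_seqE /= eq_sym.
Qed.

End Entries.

(** * Realizable scalar series and rational functions *)

Section RealizableSeries.
Variables (R : realType) (n : nat).
Implicit Types (f g : wseries R).

Definition realizable_series f := realization n (f%:M : 'M[wseries R]_1).

Lemma realizable_series_wconst c : realizable_series (wconst c).
Proof. by rewrite /realizable_series -map_scalar_mx; exact: realization_cst. Qed.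

Lemma realizable_seriesD f g :
  realizable_series f -> realizable_series g -> realizable_series (f + g).
Proof. by rewrite /realizable_series raddfD; exact: realizationD. Qed.

Lemma realizable_seriesM f g :
  realizable_series f -> realizable_series g -> realizable_series (f * g).
Proof. by rewrite /realizable_series scalar_mxM; exact: realizationM. Qed.

Lemma realizable_series_prod (I : Type) (s : seq I) (P : pred I)
    (F : I -> wseries R) :
  (forall i, P i -> realizable_series (F i)) ->
  realizable_series (\prod_(i <- s | P i) F i).
Proof.
move=> rF; elim/big_ind : _ => //; last exact: realizable_seriesM.
exact: realizable_series_wconst.
Qed.

Lemma realizable_seriesX f k :
  realizable_series f -> realizable_series (f ^+ k).
Proof.
by move=> rf; rewrite -[k]subn0 -prodr_const_nat; apply: realizable_series_prod => *.
Qed.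

Lemma realizable_series_Hbasis k :
  (k < n)%N -> realizable_series (Hbasis R (unit_index k)).
Proof.
move=> kn; apply: realization_linear => i j; rewrite mxE !ord1 mulr1n.
exact: linear_form_Hbasis.
Qed.

Lemma realizable_series_poly (P : mpoly.mpoly n R) :
  realizable_series (series_of_poly P).
Proof.
rewrite /series_of_poly /mpoly.mmap; elim/big_ind : _ => [||m _].
- by rewrite -(rmorph0 (@wconst R)); exact: realizable_series_wconst.
- exact: realizable_seriesD.
apply: realizable_seriesM; first exact: realizable_series_wconst.
apply: realizable_series_prod => i _.
exact/realizable_seriesX/realizable_series_Hbasis.
Qed.

(** Division by a denominator [g]: h = 1 - g / c has zero constant term and f = h f + (g f) / c, so
    f = (1 - h)^(-1) (g f) / c. *)
Lemma realizable_series_div f g :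
  const_term g != 0 -> realizable_series g -> realizable_series (g * f) ->
  realizable_series f.
Proof.
set c := const_term g => c0 rg rgf.
pose h := 1 - wconst c^-1 * g.
have h0 : const_coef (h%:M : 'M[wseries R]_1) = 0.
  apply/matrixP => i j; rewrite !mxE !ord1 mulr1n -/(const_term h).
  by rewrite rmorphB rmorph1 rmorphM /= const_term_wconst mulVf // subrr.
have fE : f%:M = h%:M *m f%:M + (wconst c^-1 * (g * f))%:M :> 'M[wseries R]_1.
  by rewrite -scalar_mxM -raddfD /= mulrBl mul1r mulrA subrK.
rewrite /realizable_series ((wick_inv_unique h0 _ _).1 fE).
apply: realizationM; last first.
  exact/realizable_seriesM/rgf/realizable_series_wconst.
(* The subtraction becomes a sum and a product with the constant -1, to which the closure lemmas
   apply. *)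
apply: realization_wick_inv => //; rewrite /h -mulN1r -(rmorph1 (@wconst R)).
rewrite -rmorphN; do !apply: realizable_seriesD; try exact: realizable_series_wconst.
apply: realizable_seriesM; first exact: realizable_series_wconst.
by apply: realizable_seriesM => //; exact: realizable_series_wconst.
Qed.

Lemma realization_sum (I : Type) (s : seq I) (P : pred I) p q
    (F : I -> 'M[wseries R]_(p, q)) :
  (forall i, P i -> realization n (F i)) ->
  realization n (\sum_(i <- s | P i) F i).
Proof.
move=> rF; elim/big_ind : _ => //; last exact: realizationD.
by rewrite -cst_mx0; exact: realization_cst.
Qed.

Lemma realization_entries p q (F : 'M[wseries R]_(p, q)) :
  (forall i j, realizable_series (F i j)) -> realization n F.
Proof.
move=> rF; rewrite (entries_decomposition F).
apply: realization_sum => i _; apply: realization_sum => j _.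
apply: realizationM (realization_cst _ _).
exact: realizationM (realization_cst _ _) (rF i j).
Qed.

(** The constant term is a ring morphism sending each variable H_(e_k) to 0, just like evaluation at
    the origin. *)
Lemma const_term_series_of_poly (P : mpoly.mpoly n R) :
  const_term (series_of_poly P) = mpoly.meval (fun=> 0) P.
Proof.
rewrite mpoly.mevalE /series_of_poly /mpoly.mmap rmorph_sum /=.
apply: eq_bigr => m _; rewrite rmorphM /= const_term_wconst; congr (_ * _).
rewrite /mpoly.mmap1 rmorph_prod /=; apply: eq_bigr => i _; rewrite rmorphXn /=.
by rewrite (const_term_linear_form (linear_form_Hbasis _ (ltn_ord i))).
Qed.

Lemma rational_realization p q (F : 'M[wseries R]_(p, q)) :
  (forall i j, rational_at0 n (F i j)) -> realization n F.
Proof.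
move=> rF; apply: realization_entries => i j; have [P [Q [Q0 QF]]] := rF i j.
apply: (@realizable_series_div _ (series_of_poly Q)).
- by rewrite const_term_series_of_poly.
- exact: realizable_series_poly.
by rewrite QF; exact: realizable_series_poly.
Qed.

(** The morphism structure lets determinants and adjugates over polynomials carry over to series
    through [map_mx]. *)
Fact series_of_poly_is_zmod_morphism : zmod_morphism (@series_of_poly R n).
Proof. exact: mpoly.mmapB. Qed.

Fact series_of_poly_is_monoid_morphism : monoid_morphism (@series_of_poly R n).
Proof.
by have [] := mpoly.mmap_is_multiplicative
  (fun k : 'I_n => Hbasis R (unit_index k)) (@wconst R).
Qed.

HB.instance Definition _ :=
  GRing.isZmodMorphism.Build (mpoly.mpoly n R) (wseries R) (@series_of_poly R n)
    series_of_poly_is_zmod_morphism.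
HB.instance Definition _ :=
  GRing.isMonoidMorphism.Build (mpoly.mpoly n R) (wseries R)
    (@series_of_poly R n) series_of_poly_is_monoid_morphism.

Lemma cst_mx_poly p q (D : 'M[R]_(p, q)) :
  cst_mx D = map_mx (@series_of_poly R n) (map_mx (@mpoly.mpolyC n R) D).
Proof. by apply/matrixP => i j; rewrite !mxE /series_of_poly mpoly.mmapC. Qed.

Lemma series_of_poly_var (k : 'I_n) :
  series_of_poly (mpoly.mpolyX R (mpoly.mnm1 k)) = Hbasis R (unit_index k).
Proof.
rewrite /series_of_poly.
rewrite -[RHS](mpoly.mmap1U (fun k : 'I_n => Hbasis R (unit_index k))).
exact: mpoly.mmapX.
Qed.

Lemma linear_mx_poly p q (L : 'M[wseries R]_(p, q)) :
  linear_mx n L -> exists L', L = map_mx (@series_of_poly R n) L'.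
Proof.
move=> /linear_mxP[A ->].
exists (\sum_(k < n) mpoly.mpolyX R (mpoly.mnm1 k) *:
          map_mx (@mpoly.mpolyC n R) (A k)).
rewrite raddf_sum; apply: eq_bigr => k _ /=; rewrite map_mxZ -cst_mx_poly.
by congr (_ *: _); exact/esym/series_of_poly_var.
Qed.

(* Cramer's rule: det (I - A) is a polynomial with constant term 1, and
   det (I - A) (I - A)^(-1) is the adjugate, a matrix of polynomials. *)
Lemma realization_rational p q (F : 'M[wseries R]_(p, q)) :
  realization n F -> forall i j, rational_at0 n (F i j).
Proof.
move=> [N [X [A [B [C [D [lA lB XE ->]]]]]]] i j.
have [A' AE] := linear_mx_poly lA; have [B' BE] := linear_mx_poly lB.
set s := @series_of_poly R n in AE BE.
have IAE : 1%:M - A = map_mx s (1%:M - A') by rewrite map_mxB map_mx1 AE.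
pose Q := \det (1%:M - A').
have sQ : s Q = \det (1%:M - A) by rewrite IAE det_map_mx.
(* Multiply (I - A) X = B by the adjugate. *)
have QX : s Q *: X = map_mx s (\adj (1%:M - A') *m B').
  rewrite map_mxM map_mx_adj -IAE -BE sQ -mul_scalar_mx -mul_adj_mx -mulmxA.
  by congr (_ *m _); rewrite mulmxBl mul1mx {1}XE addrAC subrr add0r.
(* The numerator is Q (D + C X), with Q X replaced by its polynomial form. *)
pose P := Q *: map_mx (@mpoly.mpolyC n R) D +
  map_mx (@mpoly.mpolyC n R) C *m (\adj (1%:M - A') *m B').
exists (P i j), Q; split.
  rewrite -const_term_series_of_poly -/s sQ -det_map_mx.
  have -> : map_mx (@const_term R) (1%:M - A) = 1%:M.
    rewrite map_mxB map_mx1 -/(const_coef A).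
    by rewrite -[X in _ - X]/(const_coef A) (const_coef_linear_mx lA) subr0.
  by rewrite det1 oner_eq0.
rewrite -/s; have -> : s (P i j) = map_mx s P i j by rewrite [RHS]mxE.
rewrite map_mxD map_mxZ map_mxM -!cst_mx_poly -QX -scalemxAr -scalerDr.
by rewrite [RHS]mxE.
Qed.

End RealizableSeries.

(** * Matrices generated by Wick operations *)

Section Generation.
Variable R : realType.

Lemma wick_generated_sum (I : Type) (s : seq I) (P : pred I) p q
    (F : I -> 'M[wseries R]_(p, q)) :
  (forall i, P i -> wick_generated (F i)) ->
  wick_generated (\sum_(i <- s | P i) F i).
Proof.
move=> gF; elim/big_ind : _ => //; last exact: wg_add.
by rewrite -cst_mx0; exact: wg_const.
Qed.

Lemma wick_generated_entries p q (F : 'M[wseries R]_(p, q)) :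
  (forall i j, wick_generated ((F i j)%:M : 'M[wseries R]_1)) -> wick_generated F.
Proof.
move=> gF; rewrite (entries_decomposition F).
apply: wick_generated_sum => i _; apply: wick_generated_sum => j _.
exact: wg_mul (wg_mul (wg_const _) (gF i j)) (wg_const _).
Qed.

Lemma wick_generated_linear n p q (A : 'I_n -> 'M[R]_(p, q)) :
  wick_generated (\sum_(k < n) Hbasis R (unit_index k) *: cst_mx (A k)).
Proof.
apply: wick_generated_sum => k _; apply: wick_generated_entries => i j.
rewrite !mxE scalar_mxM -map_scalar_mx -mx11_scalar_series.
apply: wg_mul; [exact: wg_Hbasis | exact: wg_const].
Qed.

(** Induction on the generation; [n] is existential since sums and products need the larger of two
    numbers of variables. *)
Lemma wick_generated_realization p q (F : 'M[wseries R]_(p, q)) :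
  wick_generated F -> exists n, realization n F.
Proof.
elim=> {p q F}.
(* One more than the largest index in [a], as a realization over [n] uses the indices below [n]. *)
- move=> a; exists (\max_(k <- enum_mset a) k).+1.
  rewrite mx11_scalar_series -[X in Hbasis R X]seq_mset_id Hbasis_seq.
  rewrite [\prod_(_ <- _) _]big_seq.
  apply: realizable_series_prod => k ka; apply: realizable_series_Hbasis.
  by rewrite ltnS; exact: (@leq_bigmax_seq _ _ xpredT id).
- by move=> p q D; exists 0; exact: realization_cst.
- move=> p q F G _ [m rF] _ [n rG]; exists (maxn m n).
  apply: realizationD; first by apply: realization_le rF; rewrite leq_maxl.
  by apply: realization_le rG; rewrite leq_maxr.
- move=> p q s F G _ [m rF] _ [n rG]; exists (maxn m n).
  apply: realizationM; first by apply: realization_le rF; rewrite leq_maxl.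
  by apply: realization_le rG; rewrite leq_maxr.
- by move=> N G G0 _ [n rG]; exists n; exact: realization_wick_inv.
Qed.

End Generation.

Theorem theorem4p2 (R : realType) (p q : nat) (p_gt0 : (0 < p)%N)
    (q_gt0 : (0 < q)%N) (F : 'M[wseries R]_(p, q))
    (F_kondratiev : forall i j, kondratiev (F i j)) :
  let realizable :=
    exists (N M : nat) (D : 'M[R]_(p, q)) (C : 'M[R]_(p, N))
           (A : 'I_M -> 'M[R]_N) (B : 'I_M -> 'M[R]_(N, q)),
      F = cst_mx D + cst_mx C
            *m wick_inv (\sum_(k < M) Hbasis R (unit_index k) *: cst_mx (A k))
            *m (\sum_(k < M) Hbasis R (unit_index k) *: cst_mx (B k)) in
  (rational_mx_at0 (map_mx (@hermite R) F) <-> realizable) /\ (realizable <-> wick_generated F).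
Proof.
move=> realizable.
(* The number M of terms in (2) is the [n] of the state-space form. *)
have realizableE : realizable <-> exists n, realization n F.
  split=> [[N [n [D [C [A [B FE]]]]]]|[n /realizationP[N [D [C [A [B FE]]]]]]].
    by exists n; apply/realizationP; exists N, D, C, A, B.
  by exists N, n, D, C, A, B.
have hermiteE : map_mx (@hermite R) F = F by apply/matrixP => i j; rewrite mxE.
split; rewrite ?hermiteE; split.
- by move=> [n rF]; apply/realizableE; exists n; exact: rational_realization.
- by move=> /realizableE[n rF]; exists n; exact: realization_rational.
- move=> [N [n [D [C [A [B ->]]]]]]; apply: wg_add; first exact: wg_const.
  apply: wg_mul; last exact: wick_generated_linear.
  apply: wg_mul; first exact: wg_const.
  (* The inversion is admissible because a matrix of linear forms has zero constant coefficient. *)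
  apply: wg_inv; last exact: wick_generated_linear.
  by apply: (@const_coef_linear_mx _ n); apply/linear_mxP; exists A.
- by move=> gF; apply/realizableE; exact: wick_generated_realization.
Qed.
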